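(* Let $\Gamma$ be one of the groups $\mathrm{B}\mathbf{D}_{2q}$ ($q\ge2$), $\mathrm{B}\mathbf{T}$, $\mathrm{B}\mathbf{O}$, $\mathrm{B}\mathbf{I}$, $D_{2^k(2r'+1)}$ ($k>2$, $r'\ge1$), $P'_{8\cdot3^k}$ ($k\ge2$), with natural representation $\rho_{\mathrm{Nat}}$, and let $m$ be a positive integer relatively prime to $|\Gamma|$. Let $\psi_0,\dots,\psi_r$ be the irreducible characters of $\Gamma$, let $(a_{ih})_{i,h=0}^r$ be the McKay matrix of $\Gamma$ relative to $\rho_{\mathrm{Nat}}$, and let $\chi_0,\dots,\chi_{m-1}$ be the irreducible characters of the cyclic group $\mathbf{C}_m$, where $\chi_j$ is the character of $\beta_j$. Let $\rho_{\mathrm{NAT}}=\rho_{\mathrm{Nat}}\otimes\beta_1$ be the natural representation of $\Gamma\times\mathbf{C}_m$. Then the McKay quiver $Q_{\rho_{\mathrm{NAT}}}(\Gamma\times\mathbf{C}_m)$ is given as follows. Its vertices are the pairs $(\psi_i,\chi_j)$ with $0\le i\le r$, $0\le j<m$ (the pair $(\psi_i,\chi_j)$ standing for the irreducible character $\psi_i\times\chi_j$). Its arrows are: from the vertex $(\psi_i,\chi_j)$ there are $a_{ih}$ arrows to the vertex $(\psi_h,\chi_{j+1})$, for each $0\le h\le r$, the index $j+1$ being taken modulo $m$ (and there are no other arrows).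
   Context: For a finite group $G$ with complex irreducible representations $\rho_0,\dots,\rho_n$ (up to isomorphism) and a complex representation $\rho$ of $G$, write $\rho\otimes\rho_i\cong\bigoplus_j a_{ij}\rho_j$. The matrix $(a_{ij})$ is the McKay matrix of $G$ relative to $\rho$. The McKay quiver $Q_\rho(G)$ has one vertex for each $\rho_i$ (or its character) and $a_{ij}$ arrows from the $i$-th vertex to the $j$-th vertex. Put $\zeta_n=e^{2\pi i/n}$. $\mathbf{C}_m$ is the cyclic group of $m$-th roots of unity, with irreducible representations $\beta_j(\zeta_m)=\zeta_m^j$, $0\le j<m$. $\mathrm{B}\mathbf{D}_{2q}$ (order $4q$), $\mathrm{B}\mathbf{T}$ (order 24), $\mathrm{B}\mathbf{O}$ (order 48), $\mathrm{B}\mathbf{I}$ (order 120) are the binary dihedral, tetrahedral, octahedral and icosahedral subgroups of $SU(2)$, i.e. the preimages under the double cover $SU(2)\to SO(3)$ of the dihedral group of order $2q$ and of the rotation groups of the tetrahedron, octahedron and icosahedron; their natural representation is the inclusion in $SU(2)$. $D_{2^k(2r'+1)}=\langle x,y\mid x^{2^k}=1,\ y^{2r'+1}=1,\ xyx^{-1}=y^{-1}\rangle$, with natural representation $x\mapsto\zeta_{2^k}\begin{pmatrix}0&1\\-1&0\end{pmatrix}$, $y\mapsto\begin{pmatrix}\zeta_{2r'+1}&0\\0&\zeta_{2r'+1}^{-1}\end{pmatrix}$. $P'_{8\cdot3^k}=\langle x,y,z\mid x^2=(xy)^2=y^2,\ zxz^{-1}=y,\ zyz^{-1}=xy,\ z^{3^k}=1\rangle$,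 with natural representation $x\mapsto\begin{pmatrix}0&\zeta_3^2\\-\zeta_3&0\end{pmatrix}$, $y\mapsto\begin{pmatrix}\zeta_3^2&1\\\zeta_3^2&-\zeta_3^2\end{pmatrix}$, $z\mapsto\zeta_{3^k}\begin{pmatrix}0&\zeta_3\\-\zeta_3^2&-1\end{pmatrix}$. For representations $V$ of $\Gamma$ and $W$ of $\mathbf{C}_m$, $V\otimes W$ is the representation of $\Gamma\times\mathbf{C}_m$ with $(g,h)(v\otimes w)=gv\otimes hw$, and $(\psi\times\chi)(g,h)=\psi(g)\chi(h)$; the $\psi_i\times\chi_j$ are exactly the distinct irreducible characters of $\Gamma\times\mathbf{C}_m$. *)

(* Defs.v *)
From HB Require Import structures.
From mathcomp Require Import all_boot all_order all_algebra all_fingroup.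
From mathcomp Require Import spectral.
From mathcomp Require Import mxrepresentation character.
From mathcomp Require Import complex ring.
From mathcomp Require Import reals trigo.

Set Implicit Arguments.
Unset Strict Implicit.
Unset Printing Implicit Defensive.

Import Order.TTheory GRing.Theory Num.Theory.
Local Open Scope ring_scope.

Section McKay.

Variables (F : fieldType) (gT : finGroupType) (G : {group gT}).

Definition rchar n (rG : mx_representation F G n) (g : gT) : F := \tr (rG g).

Definition complete_irr (I : finType) (irr : I -> representation F G) : Prop :=
  [/\ forall i, mx_irreducible (irr i),
      forall i j, mx_rsim (irr i) (irr j) -> i = j
    & forall n (rG : mx_representation F G n),
        mx_irreducible rG -> exists i, mx_rsim rG (irr i)].

Definition is_mckay_matrix n (rho : mx_representation F G n)
    (I : finType) (irr : I -> representation F G) (a : I -> I -> nat) : Prop :=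
  forall i, mx_rsim (prod_repr rho (irr i))
                    (\big[dadd_grepr/grepr0]_j muln_grepr (irr j) (a i j)).

(* The quiver with vertex set V and [arrows v w] arrows from v to w is the
   McKay quiver relative to rho, the vertex v standing for the irreducible
   character [chr v].  Only the values of [chr v] on G are relevant. *)
Definition is_mckay_quiver n (rho : mx_representation F G n)
    (V : finType) (chr : V -> gT -> F) (arrows : V -> V -> nat) : Prop :=
  exists irr : V -> representation F G,
    [/\ complete_irr irr,
        forall v, {in G, rchar (irr v) =1 chr v}
      & is_mckay_matrix rho irr arrows].

End McKay.

Section OuterTensor.

Variables (F : fieldType) (gT hT : finGroupType).
Variables (G : {group gT}) (H : {group hT}) (n1 n2 : nat).
Variables (rG : mx_representation F G n1) (rH : mx_representation F H n2).

Lemma outer_mx_repr :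
  mx_repr (setX_group G H) (fun x => tprod (rG x.1) (rH x.2)).
Proof.
split=> [|x y]; first by rewrite !repr_mx1 tprod1.
by rewrite !inE => /andP[x1 x2] /andP[y1 y2]; rewrite !repr_mxM // tprodE.
Qed.

Definition outer_repr := MxRepresentation outer_mx_repr.

End OuterTensor.

Section RootsOfUnity.

Variable R : realType.

Definition zeta (n : nat) : R[i] :=
  Complex (cos (pi *+ 2 / n%:R)) (sin (pi *+ 2 / n%:R)).

Lemma zetaX n k :
  zeta n ^+ k = Complex (cos (pi *+ 2 / n%:R *+ k)) (sin (pi *+ 2 / n%:R *+ k)).
Proof.
rewrite /zeta; set t := pi *+ 2 / n%:R.
elim: k => [|k IHk]; first by rewrite expr0 !mulr0n cos0 sin0.
rewrite exprS IHk mulrS cosD sinD; apply/eqP.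
by rewrite eq_complex /= eqxx addrC eqxx.
Qed.

Lemma zeta_prim n : (0 < n)%N -> n.-primitive_root (zeta n).
Proof.
move=> n_gt0; rewrite /primitive_root_of_unity n_gt0; apply/forallP=> i.
have n_neq0 : n%:R != 0 :> R by rewrite pnatr_eq0 -lt0n.
rewrite unity_rootE zetaX; case: (eqVneq i.+1 n) => [->|i_neq].
  by rewrite -[_ *+ n]mulr_natr divfK // cos2pi sin2pi eqxx.
have i_lt : (i.+1 < n)%N by rewrite ltn_neqAle i_neq ltn_ord.
rewrite eqbF_neg; apply/negP=> /eqP[].
have -> : pi *+ 2 / n%:R *+ i.+1 = (pi * (i.+1%:R / n%:R)) *+ 2 :> R.
  rewrite -[LHS]mulr_natr -[RHS]mulr_natr -[pi *+ 2]mulr_natr -!mulrA.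
  by congr (_ * _); rewrite mulrC -mulrA mulrCA.
set y := pi * _; rewrite cos_mulr2n cos2sin2 => cos2y _.
have pi0 : 0 < pi :> R by exact: pi_gt0.
have y_lt : 0 < y < pi.
  rewrite /y mulr_gt0 ?divr_gt0 ?ltr0n //= gtr_pMr //.
  by rewrite ltr_pdivrMr ?ltr0n // mul1r ltr_nat.
have : 0 < sin y by exact: sin_gt0_pi.
have : sin y ^+ 2 = 0.
  have -> : sin y ^+ 2 = (1 - ((1 - sin y ^+ 2) *+ 2 - 1)) / 2 by field.
  by rewrite cos2y subrr mul0r.
by move/eqP; rewrite expf_eq0 /= => /eqP->; rewrite ltxx.
Qed.

(* The exponent [m.-1.+1] is m when m > 0 and keeps the type finite. *)
Definition mu_pred (m : nat) (z : R[i]) := z ^+ m.-1.+1 == 1.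

Definition mu (m : nat) := {z : R[i] | mu_pred m z}.

Section Group.

Variable m : nat.

HB.instance Definition _ := SubChoice.on (mu m).

Let mu_prim : m.-1.+1.-primitive_root (zeta m.-1.+1) := zeta_prim (ltn0Sn _).

Lemma mu_exp_proof (k : 'I_m.-1.+1) :
  mu_pred m (zeta m.-1.+1 ^+ k).
Proof. by rewrite /mu_pred exprAC (prim_expr_order mu_prim) expr1n. Qed.

Definition mu_exp (k : 'I_m.-1.+1) : mu m := exist (mu_pred m) _ (mu_exp_proof k).

Definition mu_log (z : mu m) : 'I_m.-1.+1 :=
  sval (prim_rootP mu_prim (eqP (valP z))).

Lemma mu_logK : cancel mu_log mu_exp.
Proof.
by move=> z; apply: val_inj; rewrite /mu_log /=; case: prim_rootP => k /= ->.
Qed.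

HB.instance Definition _ : isCountable (mu m) := CanIsCountable mu_logK.
HB.instance Definition _ : isFinite (mu m) := CanIsFinite mu_logK.

Lemma mu_one_proof : mu_pred m 1.
Proof. by rewrite /mu_pred expr1n. Qed.

Lemma mu_mul_proof (x y : mu m) : mu_pred m (val x * val y).
Proof. by rewrite /mu_pred exprMn (eqP (valP x)) (eqP (valP y)) mulr1. Qed.

Lemma mu_inv_proof (x : mu m) : mu_pred m (val x)^-1.
Proof. by rewrite /mu_pred exprVn (eqP (valP x)) invr1. Qed.

Definition mu_one : mu m := exist (mu_pred m) _ mu_one_proof.
Definition mu_mul (x y : mu m) : mu m := exist (mu_pred m) _ (mu_mul_proof x y).
Definition mu_inv (x : mu m) : mu m := exist (mu_pred m) _ (mu_inv_proof x).

Lemma mu_mulA : associative mu_mul.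
Proof. by move=> x y z; apply: val_inj; rewrite /= mulrA. Qed.

Lemma mu_mul1 : left_id mu_one mu_mul.
Proof. by move=> x; apply: val_inj; rewrite /= mul1r. Qed.

Lemma mu_mulV : left_inverse mu_one mu_inv mu_mul.
Proof.
case=> z z1; apply: val_inj; rewrite /= mulVf //; apply: contraTneq z1 => ->.
by rewrite /mu_pred expr0n /= eq_sym oner_eq0.
Qed.

HB.instance Definition _ :=
  Finite_isGroup.Build (mu m) mu_mulA mu_mul1 mu_mulV.

Lemma beta_mx_repr j :
  mx_repr [set: mu m] (fun z => (val z ^+ j)%:M : 'M[R[i]]_1).
Proof.
split=> [|x y _ _]; first by rewrite /= expr1n.
by rewrite /= exprMn scalar_mxM.
Qed.

Definition beta j := MxRepresentation (beta_mx_repr j).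

End Group.

End RootsOfUnity.

Definition seqmx (T : nmodType) m n (s : seq (seq T)) : 'M[T]_(m, n) :=
  \matrix_(i, j) (nth [::] s i)`_j.

Section BinaryGroups.

Variable R : realType.

Definition in_SU2 (U : 'M[R[i]]_2) : Prop := U \is unitarymx /\ \det U = 1.

Definition in_SO3 (M : 'M[R]_3) : Prop := M *m M^T = 1%:M /\ \det M = 1.

Definition vec3 (x y z : R) : 'cV[R]_3 := seqmx 3 1 [:: [:: x]; [:: y]; [:: z]].

(* R^3 is identified with the traceless Hermitian matrices by means of the
   Pauli matrices. *)
Definition hermitian_of (v : 'cV[R]_3) : 'M[R[i]]_2 :=
  let x := v 0 0 in let y := v 1 0 in let z := v 2 0 in
  seqmx 2 2 [:: [:: Complex z 0; Complex x (- y)];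
                [:: Complex x y; Complex (- z) 0]].

(* The double cover SU(2) -> SO(3) sends U to M: conjugation by U acts on the
   traceless Hermitian matrices as the rotation M. *)
Definition double_cover (U : 'M[R[i]]_2) (M : 'M[R]_3) : Prop :=
  forall v, U *m hermitian_of v *m map_mx Num.conj U^T = hermitian_of (M *m v).

Definition rotation_z (t : R) : 'M[R]_3 :=
  seqmx 3 3 [:: [:: cos t; - sin t; 0]; [:: sin t; cos t; 0]; [:: 0; 0; 1]].

Definition half_turn_x : 'M[R]_3 :=
  seqmx 3 3 [:: [:: 1; 0; 0]; [:: 0; -1; 0]; [:: 0; 0; -1]].

Definition dihedral_rotation (q : nat) (M : 'M[R]_3) : Prop :=
  exists (k : nat) (e : bool),
    M = rotation_z (pi *+ 2 / q%:R) ^+ k *m half_turn_x ^+ e.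

Definition symmetry_rotation (V : seq 'cV[R]_3) (M : 'M[R]_3) : Prop :=
  in_SO3 M /\ forall v, (M *m v \in V) = (v \in V).

Definition tetrahedron : seq 'cV[R]_3 :=
  [:: vec3 1 1 1; vec3 1 (-1) (-1); vec3 (-1) 1 (-1); vec3 (-1) (-1) 1].

Definition octahedron : seq 'cV[R]_3 :=
  [:: vec3 1 0 0; vec3 (-1) 0 0; vec3 0 1 0;
      vec3 0 (-1) 0; vec3 0 0 1; vec3 0 0 (-1)].

Definition golden_ratio : R := (1 + Num.sqrt 5) / 2.

Definition icosahedron : seq 'cV[R]_3 :=
  let f := golden_ratio in
  [:: vec3 0 1 f; vec3 0 1 (- f); vec3 0 (-1) f; vec3 0 (-1) (- f);
      vec3 1 f 0; vec3 1 (- f) 0; vec3 (-1) f 0; vec3 (-1) (- f) 0;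
      vec3 f 0 1; vec3 (- f) 0 1; vec3 f 0 (-1); vec3 (- f) 0 (-1)].

(* rG identifies G with the preimage in SU(2) of the rotation group D, placed
   in R^3 up to an arbitrary rotation Q of the coordinate axes. *)
Definition binary_natural (D : 'M[R]_3 -> Prop) (gT : finGroupType)
    (G : {group gT}) (rG : mx_representation R[i] G 2) : Prop :=
  mx_faithful rG /\
  exists2 Q, in_SO3 Q &
    forall U, (exists2 g, g \in G & rG g = U) <->
      (in_SU2 U /\ exists2 M, D M & double_cover U (Q *m M *m Q^T)).

End BinaryGroups.

Section PresentedGroups.

Variables (R : realType) (gT : finGroupType) (G : {group gT}).
Variable rG : mx_representation R[i] G 2.

(* G \isog Grp (...) makes the generators x and y anonymous.  As the presented
   group is finite, any generators of G subject to the same relations are the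
   images of the presentation's generators under an isomorphism. *)
Definition D_natural (k r' : nat) : Prop :=
  (G \isog Grp (x : y :
    x ^+ (2 ^ k), y ^+ (r'.*2.+1), x * y * x^-1 = y^-1))%g /\
  exists x y : gT,
    [/\ <<[set x; y]>>%g = G,
        [/\ x ^+ (2 ^ k) = 1, y ^+ r'.*2.+1 = 1 & x * y * x^-1 = y^-1]%g,
        rG x = zeta R (2 ^ k) *: seqmx 2 2 [:: [:: 0; 1]; [:: -1; 0]]
      & rG y = let w := zeta R r'.*2.+1 in
               seqmx 2 2 [:: [:: w; 0]; [:: 0; w^-1]]].

Definition P'_natural (k : nat) : Prop :=
  (G \isog Grp (x : y : z :
    x ^+ 2 = (x * y) ^+ 2 = y ^+ 2,
    z * x * z^-1 = y, z * y * z^-1 = x * y, z ^+ (3 ^ k)))%g /\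
  exists x y z : gT,
    let w := zeta R 3 in
    [/\ <<[set x; y; z]>>%g = G,
        [/\ x ^+ 2 = (x * y) ^+ 2, (x * y) ^+ 2 = y ^+ 2,
            z * x * z^-1 = y, z * y * z^-1 = x * y & z ^+ (3 ^ k) = 1]%g,
        rG x = seqmx 2 2 [:: [:: 0; w ^+ 2]; [:: - w; 0]],
        rG y = seqmx 2 2 [:: [:: w ^+ 2; 1]; [:: w ^+ 2; - w ^+ 2]]
      & rG z = zeta R (3 ^ k) *: seqmx 2 2 [:: [:: 0; w]; [:: - w ^+ 2; -1]]].

End PresentedGroups.

Variant natural_representation (R : realType) (gT : finGroupType)
    (G : {group gT}) (rG : mx_representation R[i] G 2) : Prop :=
  | NaturalBD q of (2 <= q)%N & binary_natural (@dihedral_rotation R q) rG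
  | NaturalBT of binary_natural (symmetry_rotation (tetrahedron R)) rG
  | NaturalBO of binary_natural (symmetry_rotation (octahedron R)) rG
  | NaturalBI of binary_natural (symmetry_rotation (icosahedron R)) rG
  | NaturalD k r' of (2 < k)%N & (1 <= r')%N & D_natural rG k r'
  | NaturalP' k of (2 <= k)%N & P'_natural rG k.

(* Main.v *)
(* The irreducible characters of a finite group are linearly independent (apply
   them to the Wedderburn idempotents of the group ring), so by Maschke's
   theorem a representation is determined up to similarity by its character,
   and the McKay matrix by the identity of characters
   [rho * chi_i = \sum_j a_ij chi_j].  As C_m is abelian, the irreducible
   representations of Gamma x C_m are the psi_i twisted by the beta_j, and
   [(Nat x beta_1) * (psi_i x beta_j) = \sum_h a_ih (psi_h x beta_(j+1))]. *)

Require Import Defs.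
From mathcomp Require Import all_boot all_order all_algebra all_fingroup.
From mathcomp Require Import mxrepresentation character complex reals.
From mathcomp Require Import pgroup.

Set Implicit Arguments.
Unset Strict Implicit.
Unset Printing Implicit Defensive.

Import GRing.Theory Num.Theory.
Local Open Scope ring_scope.

(** * Decomposition into irreducibles and independence of their characters *)

Section CompleteFamily.

Variables (F : numClosedFieldType) (gT : finGroupType) (G : {group gT}).

Lemma pchar_num_pgroup : pgroup ([pchar F]^')%N G.
Proof.
by apply: sub_in_pnat (pnat_pi (cardG_gt0 G)) => p _ _; rewrite inE /= pchar_num.
Qed.

(** The coefficients [a] depend on [A] alone, so a single linear combination over [G] can be applied
    to a relation between several characters at once. *)
Lemma mxtrace_gring_op A :
  (A \in group_ring F G)%MS ->
  exists a : gT -> F, forall n (rG : mx_representation F G n),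
    \tr (gring_op rG A) = \sum_(x in G) a x * rchar rG x.
Proof.
case/envelop_mxP=> a ->; exists a => n rG.
rewrite !linear_sum; apply: eq_bigr => x Gx.
by rewrite !linearZ /= gring_opG.
Qed.

Lemma rchar_dadd (rG1 rG2 : representation F G) x :
  rchar (dadd_grepr rG1 rG2) x = rchar rG1 x + rchar rG2 x.
Proof. exact: mxtrace_block. Qed.

Lemma rchar_dsum (I : finType) (rG : I -> representation F G) x :
  rchar (\big[dadd_grepr/grepr0]_i rG i) x = \sum_i rchar (rG i) x.
Proof.
apply: (big_morph (fun rG : representation F G => rchar rG x)).
  by move=> rG1 rG2; rewrite rchar_dadd.
exact: mxtrace1.
Qed.

Lemma rchar_muln (rG : representation F G) k x :
  rchar (muln_grepr rG k) x = rchar rG x *+ k.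
Proof. by rewrite rchar_dsum sumr_const card_ord. Qed.

Variables (I : finType) (irr : I -> representation F G).
Hypothesis irr_complete : complete_irr irr.

Local Notation dsum k :=
  (\big[dadd_grepr/grepr0]_i muln_grepr (irr i) (k i)).

Lemma rchar_complete_dsum k x :
  rchar (dsum k) x = \sum_i rchar (irr i) x *+ k i.
Proof. by rewrite rchar_dsum; apply: eq_bigr => i _; rewrite rchar_muln. Qed.

(** By Maschke the socle is the whole space, and it is the direct sum of its isotypic components.
    These are reindexed by [I], a type that does not occur getting multiplicity 0. *)
Lemma complete_irr_decomposition n (rG : mx_representation F G n) :
  exists k : I -> nat, mx_rsim rG (dsum k).
Proof.
case: irr_complete => _ _ irr_onto.
pose sG : socleType rG := DecSocleType rG.
have [c rsim_c] : exists c : sG -> I,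
    forall W, mx_rsim (socle_repr W) (irr (c W)).
  exact: (fin_all_exists (fun W : sG => irr_onto _ _ (socle_irr W))).
have c_inj : injective c.
  move=> W1 W2 eqc; apply/eqP/socle_rsimP.
  by apply: mx_rsim_trans (rsim_c W1) _; rewrite eqc; exact: mx_rsim_sym.
(* Partial inverse of [c]: the isotypic component of type [i], if there is one. *)
pose soc i := [pick W | c W == i].
have socK W : soc (c W) = Some W.
  by rewrite /soc; case: pickP => [W' /eqP/c_inj-> | /(_ W)/eqP].
pose U i : 'M_n := if soc i is Some W then W : 'M_n else 0.
pose k i := if soc i is Some W then socle_mult W else 0%N.
have modU i : mxmodule rG (U i).
  rewrite /U; case: (soc i) => [W|]; last exact: mxmodule0.
  exact: component_mx_module.
have Socle1 : Socle sG = 1%:M.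
  exact: reducible_Socle1 (mx_Maschke_pchar rG pchar_num_pgroup).
have defU : (\sum_i U i :=: 1%:M)%MS.
  apply/eqmxP; rewrite submx1 -{1}Socle1; apply/sumsmx_subP=> W _.
  by rewrite (sumsmx_sup (c W)) // /U socK.
have dxU : mxdirect (\sum_i U i).
  (* Directness is an equality of ranks: the ranks of the components are grouped by type, and
     injectivity of [c] leaves at most one component per type. *)
  apply/mxdirectP; rewrite /= defU -Socle1 (mxdirectP (Socle_direct sG)) /=.
  rewrite (partition_big c xpredT) //=; apply: eq_bigr => i _.
  rewrite /U /soc; case: pickP => [W /eqP <- | noW].
    by rewrite (big_pred1 W) // => W'; rewrite /= (inj_eq c_inj).
  by rewrite mxrank0 big_pred0.
(* [mx_rsim_dsum] splits a submodule, so [rG] is first viewed as its own full submodule. *)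
have rsim1 := mx_rsim_sym (rsim_submod1 (mxmodule1 rG) (eqmx_refl _)).
exists k; apply: mx_rsim_trans rsim1 _.
apply: (mx_rsim_dsum (modU := modU) _ defU dxU) => i.
move: (modU i); rewrite /U /k /soc; case: pickP => [W /eqP <- modW | _ mod0].
  rewrite (bool_irrelevance modW (component_mx_module rG (socle_base W))).
  exact: mx_rsim_socle.
(* For a type that does not occur both sides have degree 0, and the matrix [0] is an isomorphism. *)
rewrite /muln_grepr big_ord0.
by exists 0 => [||x _]; rewrite /row_free ?mxrank0 ?mulmx0 ?mul0mx.
Qed.

(** The witness is the Wedderburn idempotent of the type of [irr i]. It kills the irreducibles of
    every other type, and since all the idempotents sum to 1 it acts as the identity on [irr i]. *)
Lemma complete_irr_idempotent i :
  exists2 A, (A \in group_ring F G)%MS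
    & forall j, gring_op (irr j) A = (i == j)%:R%:M.
Proof.
case: irr_complete => irrG irr_inj _.
pose sG : irrType F G := DecSocleType (regular_repr F G).
have F'G := pchar_num_pgroup.
have comp_inj : injective (fun j => irr_comp sG (irr j)).
  move=> j1 j2 /= eqj; apply: irr_inj.
  apply: mx_rsim_trans (rsim_irr_comp_pchar sG F'G (irrG j1)) _.
  by rewrite eqj; apply/mx_rsim_sym/rsim_irr_comp_pchar.
have op0 j W : W != irr_comp sG (irr j) ->
    gring_op (irr j) (Wedderburn_id W) = 0.
  move=> neW; apply: (irr_comp'_op0_pchar F'G (irrG j) neW).
  exact: Wedderburn_id_mem.
exists (Wedderburn_id (irr_comp sG (irr i))).
  rewrite -(Wedderburn_sum_pchar sG F'G) (sumsmx_sup (irr_comp sG (irr i))) //.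
  exact: Wedderburn_id_mem.
move=> j; have [<- | neq_ij] := eqVneq i j; last first.
  by rewrite op0 ?raddf0 //; apply: contraNneq neq_ij => /comp_inj ->.
rewrite -(gring_op1 (irr i)) -(Wedderburn_sum_id_pchar sG F'G) linear_sum /=.
rewrite (bigD1 (irr_comp sG (irr i))) //= [X in _ + X]big1 ?addr0 //.
by move=> W; exact: op0.
Qed.

(** Evaluating the relation at the idempotent of [irr i] leaves only the [i]-th term,
    [rdegree (irr i) * k i]; in characteristic 0 the positive degree cancels. *)
Lemma complete_irr_free (k1 k2 : I -> nat) :
    {in G, forall x, \sum_i rchar (irr i) x *+ k1 i
                   = \sum_i rchar (irr i) x *+ k2 i} ->
  k1 =1 k2.
Proof.
move=> eqk i; have [irrG _ _] := irr_complete.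
have [A RA opA] := complete_irr_idempotent i.
have [a trA] := mxtrace_gring_op RA.
have coef (k : I -> nat) :
    \sum_(x in G) a x * (\sum_j rchar (irr j) x *+ k j)
      = (rdegree (irr i) * k i)%:R.
  under eq_bigr => x _ do rewrite mulr_sumr.
  rewrite exchange_big (bigD1 i) //= [X in _ + X]big1 ?addr0 => [|j neq_ji].
    under eq_bigr => x _ do rewrite mulrnAr.
    by rewrite sumrMnl -trA opA eqxx mxtrace1 natrM mulr_natr.
  under eq_bigr => x _ do rewrite mulrnAr.
  by rewrite sumrMnl -trA opA eq_sym (negPf neq_ji) raddf0 mxtrace0 mul0rn.
have [n_gt0 _] := iffLR (mx_irrP _) (irrG i).
have /eqP : (rdegree (irr i) * k1 i)%:R = (rdegree (irr i) * k2 i)%:R :> F.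
  by rewrite -!coef; apply: eq_bigr => x Gx; rewrite eqk.
by rewrite eqr_nat eqn_pmul2l // => /eqP.
Qed.

Lemma rchar_rsim n1 n2 (rG1 : mx_representation F G n1)
    (rG2 : mx_representation F G n2) :
  {in G, rchar rG1 =1 rchar rG2} -> mx_rsim rG1 rG2.
Proof.
move=> eq12.
have [[k1 rsim1] [k2 rsim2]] :=
  (complete_irr_decomposition rG1, complete_irr_decomposition rG2).
have eqk : k1 =1 k2.
  apply: complete_irr_free => x Gx; rewrite -!rchar_complete_dsum.
  apply: etrans (esym (mxtrace_rsim rsim1 Gx)) _.
  exact: etrans (eq12 x Gx) (mxtrace_rsim rsim2 Gx).
apply: mx_rsim_trans rsim1 (mx_rsim_sym _).
by rewrite (eq_bigr _ (fun i _ => congr1 (muln_grepr (irr i)) (eqk i))).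
Qed.

Lemma is_mckay_matrixP n (rho : mx_representation F G n) (a : I -> I -> nat) :
  is_mckay_matrix rho irr a <->
  forall i, {in G, forall x, rchar rho x * rchar (irr i) x
                           = \sum_j rchar (irr j) x *+ a i j}.
Proof.
split=> [mckay i x Gx | eq_char i].
  rewrite -rchar_complete_dsum -mxtrace_prod.
  exact: (mxtrace_rsim (mckay i) Gx).
apply: rchar_rsim => x Gx.
by rewrite rchar_complete_dsum -eq_char // /rchar mxtrace_prod.
Qed.

End CompleteFamily.

(** * Twists by degree 1 representations and restriction to the factors *)

Section LinearTwist.

Variables (F : fieldType) (gT hT : finGroupType).
Variables (G : {group gT}) (H : {group hT}).

Lemma linear_reprM (rH : mx_representation F H 1) :
  {in H &, forall x y, rH (x * y)%g 0 0 = rH x 0 0 * rH y 0 0}.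
Proof. by move=> x y Hx Hy; rewrite repr_mxM // mxE big_ord1. Qed.

Lemma twist_mx_repr n (rG : mx_representation F G n)
    (rH : mx_representation F H 1) :
  mx_repr (setX_group G H) (fun x => rH x.2 0 0 *: rG x.1).
Proof.
split=> [|x y]; first by rewrite !repr_mx1 mxE eqxx scale1r.
rewrite !inE => /andP[Gx Hx] /andP[Gy Hy] /=.
rewrite linear_reprM // repr_mxM //.
by rewrite -scalemxAl -scalemxAr scalerA.
Qed.

(* Similar to [outer_repr rG rH], but in degree [n] instead of [n * 1]. *)
Definition twist_repr n rG rH := MxRepresentation (@twist_mx_repr n rG rH).

Lemma twist_repr1 n (rG : mx_representation F G n) rH g :
  twist_repr rG rH (g, 1%g) = rG g.
Proof. by rewrite /= repr_mx1 mxE eqxx scale1r. Qed.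

Lemma twist_repr2 n (rG : mx_representation F G n) rH h :
  twist_repr rG rH (1%g, h) = (rH h 0 0)%:M.
Proof. by rewrite /= repr_mx1 scalemx1. Qed.

Lemma rchar_twist n (rG : mx_representation F G n) rH x :
  rchar (twist_repr rG rH) x = rchar rG x.1 * rchar rH x.2.
Proof. by rewrite /rchar mxtraceZ mulrC [\tr (rH _)]big_ord1. Qed.

Lemma fst_mx_repr n (rGH : mx_representation F (setX_group G H) n) :
  mx_repr G (fun g => rGH (g, 1%g)).
Proof.
split=> [|x y Gx Gy]; first exact: repr_mx1.
by rewrite -repr_mxM ?inE ?Gx ?Gy ?group1 //; congr (rGH (_, _)); rewrite mulg1.
Qed.

Definition fst_repr n rGH := MxRepresentation (@fst_mx_repr n rGH).

Lemma snd_mx_repr n (rGH : mx_representation F (setX_group G H) n) :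
  mx_repr H (fun h => rGH (1%g, h)).
Proof.
split=> [|x y Hx Hy]; first exact: repr_mx1.
by rewrite -repr_mxM ?inE ?Hx ?Hy ?group1 //; congr (rGH (_, _)); rewrite mulg1.
Qed.

Definition snd_repr n rGH := MxRepresentation (@snd_mx_repr n rGH).

Lemma setX_repr_split n (rGH : mx_representation F (setX_group G H) n) g h :
  g \in G -> h \in H -> rGH (g, h) = fst_repr rGH g *m snd_repr rGH h.
Proof.
move=> Gg Hh; rewrite /= -repr_mxM ?inE ?Gg ?Hh ?group1 //.
by congr (rGH (_, _)); rewrite (mulg1, mul1g).
Qed.

(** A subspace stable under [G x H] is stable under [G x 1]. *)
Lemma fst_repr_irr n (rGH : mx_representation F (setX_group G H) n) :
  mx_irreducible (fst_repr rGH) -> mx_irreducible rGH.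
Proof.
case/mx_irrP=> n_gt0 irrG; apply/mx_irrP; split=> // U modU; apply: irrG.
apply/mxmoduleP=> g Gg; apply: (mxmoduleP modU).
by rewrite inE Gg group1.
Qed.

Lemma fst_repr_rsim n1 n2 (rGH1 : mx_representation F (setX_group G H) n1)
    (rGH2 : mx_representation F (setX_group G H) n2) :
  mx_rsim rGH1 rGH2 -> mx_rsim (fst_repr rGH1) (fst_repr rGH2).
Proof.
case=> f eqn f_free hom_f; exists f => // g Gg.
by apply: hom_f; rewrite inE Gg group1.
Qed.

Lemma snd_repr_rsim n1 n2 (rGH1 : mx_representation F (setX_group G H) n1)
    (rGH2 : mx_representation F (setX_group G H) n2) :
  mx_rsim rGH1 rGH2 -> mx_rsim (snd_repr rGH1) (snd_repr rGH2).
Proof.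
case=> f eqn f_free hom_f; exists f => // h Hh.
by apply: hom_f; rewrite inE Hh group1.
Qed.

Lemma fst_twist_rsim n (rG : mx_representation F G n) rH :
  mx_rsim (fst_repr (twist_repr rG rH)) rG.
Proof.
exists 1%:M => //; first by rewrite row_free_unit unitmx1.
by move=> g Gg; rewrite mulmx1 mul1mx; exact: twist_repr1.
Qed.

End LinearTwist.

(** * Irreducibles of a product with an abelian factor *)

Section CompleteTwist.

Variables (F : numClosedFieldType) (gT hT : finGroupType).
Variables (G : {group gT}) (H : {group hT}) (I J : finType).
Variables (irr : I -> representation F G) (lin : J -> mx_representation F H 1).

(** Restriction to [G x 1] recovers [i], and the scalars by which [1 x H] acts recover [j].
    Conversely, on an irreducible of the product [1 x H] acts by scalars, so the restriction to
    [G x 1] stays irreducible. *)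
Lemma complete_irr_twist :
    abelian H -> complete_irr irr ->
    complete_irr (fun j => Representation (lin j)) ->
  complete_irr
    (fun v : I * J => Representation (twist_repr (irr v.1) (lin v.2))).
Proof.
move=> abH [irrG irr_inj irr_onto] [_ lin_inj lin_onto].
split=> [[i j] | [i1 j1] [i2 j2] | n rGH irrGH] /=.
- apply: fst_repr_irr; apply: mx_rsim_irr (irrG i).
  exact/mx_rsim_sym/fst_twist_rsim.
- move=> rsim12; congr (_, _).
    apply: irr_inj; apply: mx_rsim_trans (fst_twist_rsim _ (lin j2)).
    apply: mx_rsim_trans (mx_rsim_sym (fst_twist_rsim _ (lin j1))) _.
    exact: fst_repr_rsim.
  apply: lin_inj => /=; exists 1%:M => //.
    by rewrite row_free_unit unitmx1.
  move=> h Hh; rewrite mulmx1 mul1mx [LHS]mx11_scalar [RHS]mx11_scalar.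
  congr (_%:M).
  (* A positive degree provides a diagonal entry in which to compare the two scalar matrices. *)
  have [n_gt0 _] := iffLR (mx_irrP _) (irrG i2).
  have := mx_rsim_scalar Hh (snd_repr_rsim rsim12) (twist_repr2 _ _ h).
  rewrite [LHS]twist_repr2 => /matrixP/(_ (Ordinal n_gt0) (Ordinal n_gt0)).
  by rewrite !mxE eqxx.
have [n_gt0 minGH] := iffLR (mx_irrP _) irrGH; pose i0 := Ordinal n_gt0.
(* [1 x H] is central, so it acts by scalars by Schur's lemma. *)
have scal h : h \in H -> snd_repr rGH h = (snd_repr rGH h i0 i0)%:M.
  move=> Hh; have absGH := group_closure_closed_field irrGH.
  have /is_scalar_mxP[c ->] : is_scalar_mx (snd_repr rGH h).
    apply: (mx_abs_irr_cent_scalar absGH); apply/centgmxP=> [[g h']].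
    rewrite inE => /andP[/= Gg Hh'].
    rewrite -!repr_mxM ?inE ?Gg ?Hh ?Hh' ?group1 //.
    congr (rGH (_, _)); rewrite /= ?(mul1g, mulg1) //.
    exact: (centsP abH).
  by rewrite mxE eqxx.
(* These scalars form a degree 1 representation of [H], hence are given by some [lin j]. *)
have lin_repr : mx_repr H (fun h => (snd_repr rGH h i0 i0)%:M : 'M_1).
  split=> [|x y Hx Hy]; first by rewrite repr_mx1 mxE eqxx.
  rewrite -scalar_mxM; congr (_%:M).
  by rewrite repr_mxM // (scal x) // (scal y) // -scalar_mxM !mxE eqxx.
have [j rsim_j] := lin_onto _ (MxRepresentation lin_repr)
  (mx_abs_irrW (linear_mx_abs_irr (MxRepresentation lin_repr) (erefl _))).
have lin_j h : h \in H -> snd_repr rGH h = (lin j h 0 0)%:M.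
  move=> Hh; rewrite (scal h Hh) (mx_rsim_scalar Hh rsim_j (erefl _)).
  by rewrite [(_%:M : 'M_1) 0 0]mxE eqxx.
have irr_fst : mx_irreducible (fst_repr rGH).
  apply/mx_irrP; split=> // U modU; apply: minGH.
  apply/mxmoduleP=> [[g h]]; rewrite inE => /andP[/= Gg Hh].
  rewrite setX_repr_split // lin_j // mulmxA mul_mx_scalar scalemx_sub //.
  exact: (mxmoduleP modU).
have [i [f eqn f_free hom_f]] := irr_onto _ _ irr_fst.
(* The intertwiner [f] for [G] also commutes with the scalars coming from [H]. *)
exists (i, j), f => // [[g h]]; rewrite inE => /andP[/= Gg Hh].
rewrite setX_repr_split // lin_j // mul_mx_scalar -scalemxAl hom_f //.
by rewrite scalemxAr.
Qed.

End CompleteTwist.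

(** * Irreducibles of the group of roots of unity *)

Section RootsOfUnity.

Variables (R : realType) (m : nat).
Hypothesis m_gt0 : (0 < m)%N.

Let mu_prim : m.-primitive_root (zeta R m) := zeta_prim R m_gt0.

Lemma rchar_beta j z : rchar (beta R m j) z = val z ^+ j.
Proof. exact: mxtrace_scalar. Qed.

Lemma mu_abelian : abelian [set: mu R m].
Proof.
by apply/centsP=> x _ y _; apply: val_inj; rewrite /= mulrC.
Qed.

Lemma mu_expr (z : mu R m) : val z ^+ m = 1.
Proof. by have /eqP := valP z; rewrite prednK. Qed.

Lemma val_mu_exp (z : mu R m) k : val (z ^+ k)%g = val z ^+ k.
Proof.
elim: k => [|k IHk]; first by rewrite expg0 expr0.
by rewrite expgS exprS -IHk.
Qed.

Lemma mu_generator :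
  exists2 z0 : mu R m, val z0 = zeta R m & forall z, exists k, z = (z0 ^+ k)%g.
Proof.
have z0P : mu_pred m (zeta R m) by rewrite /mu_pred prednK // prim_expr_order.
exists (exist (mu_pred m) (zeta R m) z0P) => // z.
have [k zE] := prim_rootP mu_prim (mu_expr z).
by exists k; apply: val_inj; rewrite val_mu_exp.
Qed.

(** All is read off the generator [z0], whose value is [zeta R m]: the powers [zeta R m ^+ j] with
    [j < m] are distinct, and an irreducible, of degree 1 as the group is abelian, sends [z0] to an
    [m]-th root of unity, hence to one of them. *)
Lemma complete_irr_beta :
  complete_irr (fun j : 'I_m => Representation (beta R m j)).
Proof.
have [z0 z0E gen_z0] := mu_generator.
split=> [j | j1 j2 rsim12 | n rH irrH].
- exact/mx_abs_irrW/linear_mx_abs_irr.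
- have := mxtrace_rsim rsim12 (in_setT z0); rewrite /= !mxtrace_scalar.
  move/eqP; rewrite /= z0E (eq_prim_root_expr mu_prim).
  by rewrite !modn_small ?ltn_ord // => /eqP/val_inj.
have n1 : n = 1%N.
  apply: mx_irr_abelian_linear irrH mu_abelian.
  exact: group_closure_closed_field.
subst n; have repX z k : rH (z ^+ k)%g = (rH z 0 0 ^+ k)%:M.
  elim: k => [|k IHk]; first by rewrite repr_mx1.
  by rewrite expgS repr_mxM ?inE // IHk {1}[rH z]mx11_scalar -scalar_mxM exprS.
have z0m : (z0 ^+ m)%g = 1%g by apply: val_inj; rewrite val_mu_exp mu_expr.
have : rH z0 0 0 ^+ m = 1.
  by have := repX z0 m; rewrite z0m repr_mx1 => /matrixP/(_ 0 0); rewrite !mxE.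
case/(prim_rootP mu_prim)=> j rH_z0; exists j, 1%:M => //.
  by rewrite row_free_unit unitmx1.
move=> z _; have [k ->] := gen_z0 z.
by rewrite mulmx1 mul1mx repX /= val_mu_exp z0E rH_z0 exprAC.
Qed.

End RootsOfUnity.

(** * The McKay quiver of the product *)

Theorem proposition6p1 (R : realType) (gT : finGroupType) (G : {group gT})
    (rhoNat : mx_representation R[i] G 2) (m r : nat)
    (irr : 'I_r.+1 -> representation R[i] G)
    (a : 'I_r.+1 -> 'I_r.+1 -> nat) :
  natural_representation rhoNat ->
  (0 < m)%N -> coprime m #|G| ->
  complete_irr irr -> is_mckay_matrix rhoNat irr a ->
  let psi i := rchar (irr i) in
  let chi (j : 'I_m) := rchar (beta R m j) in
  let rhoNAT := outer_repr rhoNat (beta R m 1) in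
  forall arrows : 'I_r.+1 * 'I_m -> 'I_r.+1 * 'I_m -> nat,
  is_mckay_quiver rhoNAT (fun v x => psi v.1 x.1 * chi v.2 x.2) arrows <->
  (forall (i h : 'I_r.+1) (j l : 'I_m),
     arrows (i, j) (h, l) = if l == ordS j then a i h else 0%N).
Proof.
move=> _ m_gt0 _ irrP mckay psi chi rhoNAT arrows.
pose chr (v : 'I_r.+1 * 'I_m) (x : gT * mu R m) := psi v.1 x.1 * chi v.2 x.2.
pose b (v w : 'I_r.+1 * 'I_m) := if w.2 == ordS v.2 then a v.1 w.1 else 0%N.
(* Multiplication by the character of [beta R m 1] shifts the index; at [j = m - 1] it wraps to 0
   because [z ^+ m = 1]. *)
have chi_ordS j z : chi (ordS j) z = val z * chi j z.
  by rewrite /chi !rchar_beta -exprS -(expr_mod j.+1 (mu_expr m_gt0 z)).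
have sum_b v x : x \in setX_group G [set: mu R m] ->
    rchar rhoNAT x * chr v x = \sum_w chr w x *+ b v w.
  case: v x => i j [g z]; rewrite inE => /andP[/= Gg _].
  transitivity (\sum_h \sum_l chr (h, l) (g, z) *+ b (i, j) (h, l)).
    rewrite /rchar mxtrace_prod /chr /= mulrACA.
    rewrite -[\tr (rhoNat g)]/(rchar rhoNat g).
    have /is_mckay_matrixP -> // := mckay; rewrite mulr_suml.
    (* For fixed [h] only the term [l = ordS j] can be nonzero. *)
    apply: eq_bigr => h _; rewrite (bigD1 (ordS j)) //= big1 ?addr0.
      by rewrite /b /= eqxx chi_ordS mxtrace_scalar expr1 mulrnAl.
    by move=> l /negPf neq_l; rewrite /b /= neq_l.
  by rewrite pair_big; apply: eq_bigr => [[h l]].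
split=> [[irr' [irr'P chr' mckay']] i h j l | arrowsE].
  (* The quiver comes with its own irreducibles [irr'], known only through their characters; linear
     independence still forces [arrows] to agree with [b]. *)
  suff /(_ (h, l)) : arrows (i, j) =1 b (i, j) by [].
  apply: (complete_irr_free irr'P) => x Gx.
  rewrite -(iffLR (is_mckay_matrixP irr'P _ _) mckay') // chr' // sum_b //.
  by apply: eq_bigr => w _; rewrite chr'.
(* Conversely, the twists are irreducibles that realise the characters [chr]. *)
pose irr' (v : 'I_r.+1 * 'I_m) :=
  Representation (twist_repr (irr v.1) (beta R m v.2)).
have irr'P : complete_irr irr'.
  apply: (complete_irr_twist (lin := fun j : 'I_m => beta R m j)) => //.
    exact: mu_abelian.
  exact: complete_irr_beta.
have chr' v x : rchar (irr' v) x = chr v x by exact: rchar_twist.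
exists irr'; split=> // [v x _ | ]; first exact: chr'.
apply/is_mckay_matrixP => // v x Gx; rewrite chr' sum_b //.
apply: eq_bigr => w _; rewrite chr'; congr (_ *+ _).
by case: v w => i j [h l]; rewrite arrowsE.
Qed.
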